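(* Let $\mathcal A\in R$ and let $\mathcal M,\mathcal N\in R$ be invertible hermitian tensors. Then the following statements are equivalent: (i) The generalized weighted Moore-Penrose inverse $\mathcal A^\dagger_{\mathcal M,\mathcal N}$ exists. (ii) There exist unique idempotent tensors $\mathcal P,\mathcal Q\in R$ such that $\mathcal M*\mathcal P=(\mathcal M*\mathcal P)^T$, $\mathcal N*\mathcal Q=(\mathcal N*\mathcal Q)^T$, $\mathcal P*R=\mathcal A*R$ and $R*\mathcal Q=R*\mathcal A$. If either of the statements (i), (ii) holds, then $\mathcal A^\dagger_{\mathcal M,\mathcal N}=\mathcal Q*\mathcal A^{(1)}*\mathcal P$, where $\mathcal A^{(1)}$ is an inner inverse of $\mathcal A$, and this expression is invariant for any choice of the inner inverse $\mathcal A^{(1)}$.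
   Context: Fix $p\ge 3$ and positive integers $n,n_3,\dots,n_p$; $R=\mathbb{R}^{n\times n\times n_3\times\cdots\times n_p}$ is the set of real tensors of this size, with entrywise addition. For $\mathcal A\in R$ let $\mathcal A_i$ ($1\le i\le n_p$) be the tensor of order $p-1$ obtained by fixing the last index at $i$. The t-product is defined recursively by $(\mathcal A*\mathcal B)_i=\sum_{j=1}^{n_p}\mathcal A_{i-j+1}*\mathcal B_j$ (indices modulo $n_p$ in $\{1,\dots,n_p\}$), where for matrices $*$ is the ordinary matrix product. The transpose is defined recursively by $(\mathcal A^T)_1=(\mathcal A_1)^T$ and $(\mathcal A^T)_i=(\mathcal A_{n_p+2-i})^T$ for $2\le i\le n_p$, with the ordinary transpose for matrices. With these operations $R$ is an associative ring with unity $\mathcal I$ (the tensor whose slice $\mathcal I(:,:,1,\dots,1)$ is the identity matrix and whose other slices are zero), and $(\mathcal A*\mathcal B)^T=\mathcal B^T*\mathcal A^T$. A (real) tensor $\mathcal M$ is hermitian if $\mathcal M^T=\mathcal M$; invertibility is in the ring $R$; $\mathcal P$ is idempotent if $\mathcal P*\mathcal P=\mathcal P$. Notation: $\mathcal A*R=\{\mathcal A*\mathcal Z:\mathcal Z\in R\}$ and $R*\mathcal A=\{\mathcal Z*\mathcal A:\mathcal Z\in R\}$. An inner inverse $\mathcal A^{(1)}$ of $\mathcal A$ is any $\mathcal Z\in R$ with $\mathcal A*\mathcal Z*\mathcal A=\mathcal A$. For invertible hermitian $\mathcal M,\mathcal N$, the generalized weighted Moore-Penrose inverse $\mathcal A^\dagger_{\mathcal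 M,\mathcal N}$ is a tensor $\mathcal Y\in R$ satisfying $\mathcal A*\mathcal Y*\mathcal A=\mathcal A$, $\mathcal Y*\mathcal A*\mathcal Y=\mathcal Y$, $(\mathcal M*\mathcal A*\mathcal Y)^T=\mathcal M*\mathcal A*\mathcal Y$ and $(\mathcal N*\mathcal Y*\mathcal A)^T=\mathcal N*\mathcal Y*\mathcal A$; it is unique when it exists. *)

(* Defs.v *)
From HB Require Import structures.
From mathcomp Require Import all_boot all_order all_algebra.
From mathcomp Require Import boolp classical_sets reals.

Set Implicit Arguments.
Unset Strict Implicit.
Unset Printing Implicit Defensive.

Import Order.TTheory GRing.Theory Num.Theory.
Local Open Scope ring_scope.

(* Tensor indices are 0-based: the slice written A_i with
   1 <= i <= d in the mathematics is the slice of index i - 1 : 'I_d here, so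
   that i - j + 1 becomes i - j mod d and d + 2 - i becomes - i mod d.  These
   residues live in 'I_d itself, not in 'Z_d, which would be wrong for d = 1. *)
Definition cyc_sub (d : nat) (i j : 'I_d) : 'I_d :=
  Ordinal (ltn_pmod (i + (d - j)) (leq_ltn_trans (leq0n i) (ltn_ord i))).

Definition cyc_opp (d : nat) (i : 'I_d) : 'I_d :=
  Ordinal (ltn_pmod (d - i) (leq_ltn_trans (leq0n i) (ltn_ord i))).

(* The real tensors of size n x n x n_3 x ... x n_p, for
   dims = [:: n_p; ...; n_3] (last mode first, since the recursion is on the
   last index), as a zmodType for the entrywise addition. *)
Fixpoint tensor (R : realType) (n : nat) (dims : seq nat) : zmodType :=
  match dims with
  | [::] => 'M[R]_n
  | d :: dims' => {ffun 'I_d -> tensor R n dims'}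
  end.

Definition slice (R : realType) (n d : nat) (dims : seq nat)
    (A : tensor R n (d :: dims)) (i : 'I_d) : tensor R n dims :=
  (A : {ffun 'I_d -> tensor R n dims}) i.

Fixpoint tmul (R : realType) (n : nat) (dims : seq nat) :
    tensor R n dims -> tensor R n dims -> tensor R n dims :=
  match dims with
  | [::] => fun A B : 'M[R]_n => A *m B
  | d :: dims' => fun A B : tensor R n (d :: dims') =>
      [ffun i : 'I_d =>
         \sum_(j < d) tmul (slice A (cyc_sub i j)) (slice B j)]
  end.

Fixpoint ttr (R : realType) (n : nat) (dims : seq nat) :
    tensor R n dims -> tensor R n dims :=
  match dims with
  | [::] => fun A : 'M[R]_n => A^T
  | d :: dims' => fun A : tensor R n (d :: dims') =>
      [ffun i : 'I_d => ttr (slice A (cyc_opp i))]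
  end.

Fixpoint tone (R : realType) (n : nat) (dims : seq nat) : tensor R n dims :=
  match dims with
  | [::] => (1%:M : 'M[R]_n)
  | d :: dims' =>
      [ffun i : 'I_d => if i == 0%N :> nat then tone R n dims' else 0]
  end.

Declare Scope tensor_scope.
Delimit Scope tensor_scope with tensor.
Notation "A *t B" := (tmul A B) (at level 40, left associativity) : tensor_scope.
Local Open Scope tensor_scope.
Local Open Scope classical_set_scope.

Section Notions.
Variables (R : realType) (n : nat) (dims : seq nat).
Local Notation T := (tensor R n dims).
Implicit Types A M N P Q Y Z : T.

Definition thermitian M : Prop := ttr M = M.

Definition tinvertible M : Prop :=
  exists Z, M *t Z = tone R n dims /\ Z *t M = tone R n dims.

Definition tidempotent P : Prop := P *t P = P.

Definition right_ideal A : set T := [set A *t Z | Z in [set: T]].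

Definition left_ideal A : set T := [set Z *t A | Z in [set: T]].

Definition inner_inverse A Z : Prop := A *t Z *t A = A.

Definition weighted_MP_inverse M N A Y : Prop :=
  [/\ A *t Y *t A = A,
      Y *t A *t Y = Y,
      ttr (M *t A *t Y) = M *t A *t Y
    & ttr (N *t Y *t A) = N *t Y *t A].

Definition weighted_projectors M N A P Q : Prop :=
  (tidempotent P /\ tidempotent Q) /\
  [/\ M *t P = ttr (M *t P),
      N *t Q = ttr (N *t Q),
      right_ideal P = right_ideal A
    & left_ideal Q = left_ideal A].

End Notions.

(* Main.v *)
Require Import Defs.
From HB Require Import structures.
From mathcomp Require Import all_boot all_order all_algebra.
From mathcomp Require Import boolp classical_sets reals.

Set Implicit Arguments.
Unset Strict Implicit.
Unset Printing Implicit Defensive.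

Import GRing.Theory.

Local Open Scope ring_scope.
Local Open Scope tensor_scope.

(** The theorem holds in any ring with a map reversing products; tensors with
    the t-product and the transpose are an instance.  The dictionary between
    the two sides is [P = A * Y], [Q = Y * A].

    The key point is rigidity of weighted projectors
    ([weighted_projector_rigidr], [weighted_projector_rigidl]).  Two
    idempotents generating the same right ideal absorb each other:
    [P' * P = P] and [P * P' = P'].  If moreover
    [M * P] and [M * P'] are hermitian, then
    [M * P = (M * P' * P)^T = P^T * (M * P') = (M * P) * P' = M * P'], and [M]
    cancels.  The left-ideal version is the same computation with the two
    absorption laws of the opposite side.  Rigidity yields uniqueness of
    [(P, Q)], and also uniqueness of the inverse, since
    [Y = Y * A * Y] is determined by [A * Y] and [Y * A].

    Conversely, given projectors, [P] lies in [A * R] and [Q] in [R * A], while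
    [P * A = A = A * Q]; so for any inner inverse [Z] the element
    [Y = Q * Z * P] satisfies [A * Y = P] and [Y * A = Q]
    ([projectors_sandwich]), from which the four defining equations are
    immediate.  An inner inverse exists: writing [P = A * U], one has
    [A * U * A = P * A = A].

    Tensors of a given size form a ring in which the transpose reverses
    products ([tmulA], [ttr_tmul]).  The laws are proved by induction on the order of the
    tensors: the t-product is a convolution over the cyclic group of last
    indices with values in the ring of lower-order tensors, so each law reduces
    to the law one order below and a translation of the summation index. *)

(** * Weighted projectors in a ring with a product-reversing map *)

Section WeightedProjectors.

Variables (T : pzRingType) (tr : T -> T).
Hypothesis trM : forall x y : T, tr (x * y) = tr y * tr x.
Implicit Types a m x y z u w : T.

(** Transposing [m * x = m * x' * x] gives
    [m * x = tr x * (m * x') = tr (m * x) * x' = m * (x * x') = m * x'].  The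
    two absorption laws are those of idempotents with a common right ideal. *)
Lemma weighted_projector_rigidr m v x x' :
  v * m = 1 -> tr m = m -> tr (m * x) = m * x -> tr (m * x') = m * x' ->
  x' * x = x -> x * x' = x' -> x = x'.
Proof.
move=> vm mh xh xh' x'x xx'.
have mx : m * x = m * x'.
  by rewrite -xh -{1}x'x mulrA trM xh' mulrA -{1}mh -trM xh -mulrA xx'.
by rewrite -[x]mul1r -vm -mulrA mx mulrA vm mul1r.
Qed.

(** The mirror case, for idempotents with a common left ideal; transposing
    [m * x = m * x * x'] gives
    [m * x = tr x' * (m * x) = tr (m * x') * x = m * (x' * x) = m * x']. *)
Lemma weighted_projector_rigidl m v x x' :
  v * m = 1 -> tr m = m -> tr (m * x) = m * x -> tr (m * x') = m * x' ->
  x * x' = x -> x' * x = x' -> x = x'.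
Proof.
move=> vm mh xh xh' xx' x'x.
have mx : m * x = m * x'.
  by rewrite -xh -{1}xx' mulrA trM xh mulrA -{1}mh -trM xh' -mulrA x'x.
by rewrite -[x]mul1r -vm -mulrA mx mulrA vm mul1r.
Qed.

(** Only the products [a * y] and [y * a] enter the hermitian conditions, and
    rigidity determines each of them. *)
Lemma weighted_inverse_unique m v n w a y y' :
  v * m = 1 -> tr m = m -> w * n = 1 -> tr n = n ->
  a * y * a = a -> y * a * y = y ->
  tr (m * a * y) = m * a * y -> tr (n * y * a) = n * y * a ->
  a * y' * a = a -> y' * a * y' = y' ->
  tr (m * a * y') = m * a * y' -> tr (n * y' * a) = n * y' * a -> y = y'.
Proof.
move=> vm mh wn nh aya yay may nya ay'a y'ay' may' ny'a.
rewrite -!mulrA in may nya may' ny'a.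
have ay : a * y = a * y'.
  by apply: (weighted_projector_rigidr vm mh may may'); rewrite mulrA ?aya ?ay'a.
have ya : y * a = y' * a.
  apply: (weighted_projector_rigidl wn nh nya ny'a).
    by rewrite -mulrA (mulrA a) ay'a.
  by rewrite -mulrA (mulrA a) aya.
by rewrite -yay ya -mulrA ay mulrA y'ay'.
Qed.

(** Each outer factor of [q * z * p] is absorbed by the neighbouring [a], which
    leaves [a * z * a]. *)
Lemma projectors_sandwich a p q u w z :
  p = a * u -> p * a = a -> q = w * a -> a * q = a -> a * z * a = a ->
  a * (q * z * p) = p /\ q * z * p * a = q.
Proof.
move=> pE pa qE aq aza; split.
  by rewrite !mulrA aq pE mulrA aza.
by rewrite -!mulrA pa qE -mulrA (mulrA a) aza.
Qed.

End WeightedProjectors.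

(** * The ring of tensors *)

(** The group law of ['I_d.+1] turns the index arithmetic of the t-product into
    cancellation in an abelian group. *)
Lemma cyc_subE d (i j : 'I_d.+1) : cyc_sub i j = i - j.
Proof. by apply: val_inj; rewrite /= modnDmr. Qed.

Lemma cyc_oppE d (i : 'I_d.+1) : cyc_opp i = - i.
Proof. exact: val_inj. Qed.

Section TensorRing.

Variables (R : realType) (n : nat).

Lemma slice_inj d dims (A B : tensor R n (d :: dims)) :
  slice A =1 slice B -> A = B.
Proof. by move=> AB; apply/ffunP. Qed.

Lemma sliceD d dims (A B : tensor R n (d :: dims)) i :
  slice (A + B) i = slice A i + slice B i.
Proof. exact: ffunE. Qed.

Lemma slice0 d dims i : slice (0 : tensor R n (d :: dims)) i = 0.
Proof. exact: ffunE. Qed.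

Lemma slice_tmul d dims (A B : tensor R n (d.+1 :: dims)) i :
  slice (A *t B) i = \sum_j slice A (i - j) *t slice B j.
Proof.
by rewrite [LHS]ffunE; apply: eq_bigr => j _; rewrite cyc_subE.
Qed.

Lemma slice_ttr d dims (A : tensor R n (d.+1 :: dims)) i :
  slice (ttr A) i = ttr (slice A (- i)).
Proof. by rewrite [LHS]ffunE cyc_oppE. Qed.

Lemma slice_tone d dims (i : 'I_d.+1) :
  slice (tone R n (d.+1 :: dims)) i = if i == 0 then tone R n dims else 0.
Proof. exact: ffunE. Qed.

Lemma tmulDl dims (A B C : tensor R n dims) :
  (A + B) *t C = A *t C + B *t C.
Proof.
elim: dims A B C => [|[|d] dims IH] A B C; first exact: mulmxDl.
  by apply: slice_inj => -[].
apply: slice_inj => i; rewrite sliceD !slice_tmul -big_split /=.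
by apply: eq_bigr => j _; rewrite sliceD IH.
Qed.

Lemma tmulDr dims (A B C : tensor R n dims) :
  A *t (B + C) = A *t B + A *t C.
Proof.
elim: dims A B C => [|[|d] dims IH] A B C; first exact: mulmxDr.
  by apply: slice_inj => -[].
apply: slice_inj => i; rewrite sliceD !slice_tmul -big_split /=.
by apply: eq_bigr => j _; rewrite sliceD IH.
Qed.

Lemma tmul0l dims (A : tensor R n dims) : 0 *t A = 0.
Proof. by apply: (addrI (0 *t A)); rewrite -tmulDl !addr0. Qed.

Lemma tmul0r dims (A : tensor R n dims) : A *t 0 = 0.
Proof. by apply: (addrI (A *t 0)); rewrite -tmulDr !addr0. Qed.

Lemma tmul_suml dims (I : finType) (F : I -> tensor R n dims) A :
  (\sum_i F i) *t A = \sum_i F i *t A.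
Proof.
exact: (big_morph (fun B => B *t A) (fun B C => tmulDl B C A) (tmul0l A)).
Qed.

Lemma tmul_sumr dims (I : finType) (F : I -> tensor R n dims) A :
  A *t (\sum_i F i) = \sum_i A *t F i.
Proof. exact: (big_morph (tmul A) (tmulDr A) (tmul0r A)). Qed.

Lemma tmulA dims (A B C : tensor R n dims) : A *t (B *t C) = A *t B *t C.
Proof.
elim: dims A B C => [|[|d] dims IH] A B C; first exact: mulmxA.
  by apply: slice_inj => -[].
apply: slice_inj => i; rewrite !slice_tmul.
under eq_bigr => j _ do rewrite slice_tmul tmul_sumr.
rewrite exchange_big /=; apply: eq_bigr => k _.
rewrite slice_tmul tmul_suml (reindex_inj (addIr k)) /=.
by apply: eq_bigr => l _; rewrite IH addrK opprD addrA addrAC.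
Qed.

Lemma tmul1l dims (A : tensor R n dims) : tone R n dims *t A = A.
Proof.
elim: dims A => [|[|d] dims IH] A; first exact: mul1mx.
  by apply: slice_inj => -[].
apply: slice_inj => i; rewrite slice_tmul (bigD1 i) //= subrr slice_tone eqxx IH.
rewrite big1 ?addr0 // => j ji.
by rewrite slice_tone subr_eq0 eq_sym (negPf ji) tmul0l.
Qed.

Lemma tmul1r dims (A : tensor R n dims) : A *t tone R n dims = A.
Proof.
elim: dims A => [|[|d] dims IH] A; first exact: mulmx1.
  by apply: slice_inj => -[].
apply: slice_inj => i; rewrite slice_tmul (bigD1 0) //= subr0 slice_tone eqxx IH.
rewrite big1 ?addr0 // => j j0.
by rewrite slice_tone (negPf j0) tmul0r.
Qed.

Lemma ttrD dims (A B : tensor R n dims) : ttr (A + B) = ttr A + ttr B.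
Proof.
elim: dims A B => [|[|d] dims IH] A B; first exact: linearD.
  by apply: slice_inj => -[].
by apply: slice_inj => i; rewrite sliceD !slice_ttr sliceD IH.
Qed.

Lemma ttr0 dims : ttr (0 : tensor R n dims) = 0.
Proof. by apply: (addrI (ttr 0)); rewrite -ttrD !addr0. Qed.

Lemma ttr_sum dims (I : finType) (F : I -> tensor R n dims) :
  ttr (\sum_i F i) = \sum_i ttr (F i).
Proof. exact: (big_morph (@ttr R n dims) (@ttrD dims) (ttr0 dims)). Qed.

Lemma ttr_tmul dims (A B : tensor R n dims) :
  ttr (A *t B) = ttr B *t ttr A.
Proof.
elim: dims A B => [|[|d] dims IH] A B; first exact: trmx_mul.
  by apply: slice_inj => -[].
apply: slice_inj => i; rewrite slice_ttr !slice_tmul ttr_sum.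
(* The index k of the right-hand convolution is j + i. *)
rewrite [RHS](reindex_inj (addIr i)) /=; apply: eq_bigr => j _.
by rewrite IH !slice_ttr opprB addrK opprD addrC.
Qed.

End TensorRing.

(** A copy of the type of tensors, to carry the ring structure whose product is
    the t-product.  Rings with [1 = 0] must be admitted, as a mode of size zero
    yields one. *)
Definition tensor_ring (R : realType) (n : nat) (dims : seq nat) : Type :=
  tensor R n dims.

HB.instance Definition _ R n dims :=
  GRing.Zmodule.on (tensor_ring R n dims).
HB.instance Definition _ R n dims :=
  GRing.Zmodule_isPzRing.Build (tensor_ring R n dims)
    (@tmulA R n dims) (@tmul1l R n dims) (@tmul1r R n dims)
    (@tmulDl R n dims) (@tmulDr R n dims).

(** * Principal ideals of tensors *)

Section Ideals.

Variables (R : realType) (n : nat) (dims : seq nat).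
Implicit Types A M N P Q Y Z : tensor R n dims.

Lemma right_ideal_id A : right_ideal A A.
Proof. by exists (tone R n dims); rewrite // tmul1r. Qed.

Lemma left_ideal_id A : left_ideal A A.
Proof. by exists (tone R n dims); rewrite // tmul1l. Qed.

Lemma idempotent_mull P A : tidempotent P -> right_ideal P A -> P *t A = A.
Proof. by move=> PP [Z _ <-]; rewrite tmulA PP. Qed.

Lemma idempotent_mulr Q A : tidempotent Q -> left_ideal Q A -> A *t Q = A.
Proof. by move=> QQ [Z _ <-]; rewrite -tmulA QQ. Qed.

Lemma right_ideal_inner A Y : A *t Y *t A = A ->
  right_ideal (A *t Y) = right_ideal A.
Proof.
move=> AYA; apply/seteqP; split=> _ [Z _ <-].
  by exists (Y *t Z); rewrite // tmulA.
by exists (A *t Z); rewrite // tmulA AYA.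
Qed.

Lemma left_ideal_inner A Y : A *t Y *t A = A ->
  left_ideal (Y *t A) = left_ideal A.
Proof.
move=> AYA; apply/seteqP; split=> _ [Z _ <-].
  by exists (Z *t Y); rewrite // tmulA.
by exists (Z *t A); rewrite // -tmulA (tmulA A) AYA.
Qed.

(** * Weighted projectors and weighted inverses *)

Lemma weighted_projectors_of_inverse M N A Y :
  weighted_MP_inverse M N A Y -> weighted_projectors M N A (A *t Y) (Y *t A).
Proof.
case=> AYA YAY MAY NYA; split; split.
- by rewrite /tidempotent tmulA AYA.
- by rewrite /tidempotent tmulA YAY.
- by rewrite tmulA MAY.
- by rewrite tmulA NYA.
- exact: right_ideal_inner.
- exact: left_ideal_inner.
Qed.

Lemma weighted_projectors_unique M N A P Q P' Q' :
  tinvertible M -> thermitian M -> tinvertible N -> thermitian N ->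
  weighted_projectors M N A P Q -> weighted_projectors M N A P' Q' ->
  (P, Q) = (P', Q').
Proof.
move=> [V [_ VM]] Mh [W [_ WN]] Nh [[PP QQ] [MP NQ PA QA]].
move=> [[PP' QQ'] [MP' NQ' PA' QA']]; congr (_, _).
  apply: (@weighted_projector_rigidr (tensor_ring R n dims) (@ttr R n dims)
            (@ttr_tmul R n dims) M V P P') => //.
    by apply: idempotent_mull => //; rewrite PA' -PA; apply: right_ideal_id.
  by apply: idempotent_mull => //; rewrite PA -PA'; apply: right_ideal_id.
apply: (@weighted_projector_rigidl (tensor_ring R n dims) (@ttr R n dims)
          (@ttr_tmul R n dims) N W Q Q') => //.
  by apply: idempotent_mulr => //; rewrite QA' -QA; apply: left_ideal_id.
by apply: idempotent_mulr => //; rewrite QA -QA'; apply: left_ideal_id.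
Qed.

Lemma weighted_MP_inverse_unique M N A Y Y' :
  tinvertible M -> thermitian M -> tinvertible N -> thermitian N ->
  weighted_MP_inverse M N A Y -> weighted_MP_inverse M N A Y' -> Y = Y'.
Proof.
move=> [V [_ VM]] Mh [W [_ WN]] Nh [AYA YAY MAY NYA] [AYA' YAY' MAY' NYA'].
exact: (@weighted_inverse_unique (tensor_ring R n dims) (@ttr R n dims)
          (@ttr_tmul R n dims) M V N W A Y Y').
Qed.

(** A right factor expressing [P] as a multiple of [A] is an inner inverse of
    [A], because [P] fixes [A]. *)
Lemma weighted_projectors_inner M N A P Q :
  weighted_projectors M N A P Q -> exists Z, inner_inverse A Z.
Proof.
move=> [[PP _] [_ _ PA _]].
have [U _ AU] : right_ideal A P by rewrite -PA; apply: right_ideal_id.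
exists U; rewrite /inner_inverse AU; apply: idempotent_mull => //.
by rewrite PA; apply: right_ideal_id.
Qed.

Lemma weighted_inverse_of_projectors M N A P Q Z :
  weighted_projectors M N A P Q -> inner_inverse A Z ->
  weighted_MP_inverse M N A (Q *t Z *t P).
Proof.
move=> [[PP QQ] [MP NQ PA QA]] AZA.
have [U _ AU] : right_ideal A P by rewrite -PA; apply: right_ideal_id.
have [W _ WA] : left_ideal A Q by rewrite -QA; apply: left_ideal_id.
have PfixA : P *t A = A.
  by apply: idempotent_mull => //; rewrite PA; apply: right_ideal_id.
have QfixA : A *t Q = A.
  by apply: idempotent_mulr => //; rewrite QA; apply: left_ideal_id.
have [AY YA] := @projectors_sandwich (tensor_ring R n dims) A P Q U W Z
  (esym AU) PfixA (esym WA) QfixA AZA.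
(* Back from the ring product to the t-product. *)
have {}AY : A *t (Q *t Z *t P) = P := AY.
have {}YA : Q *t Z *t P *t A = Q := YA.
split.
- by rewrite AY PfixA.
- by rewrite YA !tmulA QQ.
- by rewrite -(tmulA M) AY -MP.
- by rewrite -(tmulA N) YA -NQ.
Qed.

End Ideals.

Theorem theorem18 (R : realType) (p : nat) (hp : (3 <= p)%N)
    (n : nat) (hn : (0 < n)%N)
    (dims : (p - 2).-tuple nat) (hdims : forall d : nat, d \in dims -> (0 < d)%N)
    (A M N : tensor R n dims)
    (M_inv : tinvertible M) (M_herm : thermitian M)
    (N_inv : tinvertible N) (N_herm : thermitian N) :
  ((exists Y : tensor R n dims, weighted_MP_inverse M N A Y) <->
   (exists! PQ : tensor R n dims * tensor R n dims,
      weighted_projectors M N A PQ.1 PQ.2)) /\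
  ((exists Y : tensor R n dims, weighted_MP_inverse M N A Y) \/
   (exists! PQ : tensor R n dims * tensor R n dims,
      weighted_projectors M N A PQ.1 PQ.2) ->
   forall P Q : tensor R n dims, weighted_projectors M N A P Q ->
     [/\ exists Z : tensor R n dims, inner_inverse A Z,
         forall Z : tensor R n dims, inner_inverse A Z ->
           unique (weighted_MP_inverse M N A) (Q *t Z *t P)
       & forall Z Z' : tensor R n dims,
           inner_inverse A Z -> inner_inverse A Z' ->
           Q *t Z *t P = Q *t Z' *t P]).
Proof.
have invP P Q Z : weighted_projectors M N A P Q -> inner_inverse A Z ->
    unique (weighted_MP_inverse M N A) (Q *t Z *t P).
  move=> PQ AZA; have Y := weighted_inverse_of_projectors PQ AZA.
  by split=> // Y'; apply: weighted_MP_inverse_unique.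
split.
  split=> [[Y AY] | [[P Q] [/= PQ _]]].
    have PQ := weighted_projectors_of_inverse AY.
    exists (A *t Y, Y *t A); split=> // -[P' Q'] /=.
    exact: weighted_projectors_unique.
  have [Z AZA] := weighted_projectors_inner PQ.
  by exists (Q *t Z *t P); apply: weighted_inverse_of_projectors.
move=> _ P Q PQ; split.
- exact: weighted_projectors_inner PQ.
- by move=> Z; apply: invP.
- (* Both expressions are the weighted inverse, which is unique. *)
  move=> Z Z' AZA AZA'; have [_] := invP P Q Z PQ AZA; apply.
  exact: weighted_inverse_of_projectors.
Qed.
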